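(* Let $\Omega \subset \mathbb{R}^n$ be a bounded convex domain with smooth boundary, let $f:\mathbb{R}\to\mathbb{R}$ be a smooth function, and let $u \in C^\infty(\overline{\Omega})$ satisfy $$-\Delta u = f(u) \ \text{ in } \Omega, \qquad u = 0 \ \text{ on } \partial\Omega.$$ Assume that $f>0$, and that $f''\le 0$ on the interval $[0,\max_{\overline{\Omega}} u]$. If $D^2u\le 0$ at every point of $\partial\Omega$, then $u$ is concave in $\Omega$.
   Context: $D^2u$ denotes the Hessian matrix of $u$ (defined up to the boundary, since $u\in C^\infty(\overline{\Omega})$), and $D^2u\le 0$ means that it is negative semidefinite as a full $n\times n$ matrix. *)

(* Defs.v *)
From HB Require Import structures.
From mathcomp Require Import all_boot all_order all_algebra.
From mathcomp Require Import all_classical all_reals all_analysis.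
Import Order.TTheory GRing.Theory Num.Theory.
Import numFieldNormedType.Exports.

Set Implicit Arguments.
Unset Strict Implicit.
Unset Printing Implicit Defensive.

Local Open Scope classical_set_scope.
Local Open Scope convex_scope.
Local Open Scope ring_scope.

Section Defs.
Context {R : realType}.

Definition partial n (i : 'I_n) (g : 'rV[R]_n -> R) : 'rV[R]_n -> R :=
  fun x => 'D_(delta_mx 0 i) g x.

(* [dpartial [:: i1; ...; ik] g] is d_{i1} ... d_{ik} g. *)
Definition dpartial n (s : seq 'I_n) (g : 'rV[R]_n -> R) : 'rV[R]_n -> R :=
  foldr (@partial n) g s.

(* C^oo(A); meant for A open, since the derivatives are two-sided. *)
Definition smooth_on n (A : set 'rV[R]_n) (g : 'rV[R]_n -> R) : Prop :=
  forall (s : seq 'I_n) (x : 'rV[R]_n), A x ->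
    {for x, continuous (dpartial s g)} /\
    forall i : 'I_n, derivable (dpartial s g) x (delta_mx 0 i).

Definition smooth_real (f : R -> R) : Prop :=
  forall (k : nat) (s : R), derivable (f^`(k))%classic s 1.

Definition domain n (Omega : set 'rV[R]_n) : Prop :=
  [/\ open Omega, connected Omega & Omega !=set0].

Definition boundary n (Omega : set 'rV[R]_n) : set 'rV[R]_n :=
  closure Omega `\` interior Omega.

(* Near each boundary point, up to relabelling and reorienting the coordinate
   axes, Omega is the region above the graph of a C^oo function of the other
   n - 1 coordinates; [col' i x] is x with its i-th coordinate deleted. *)
Definition smooth_boundary n (Omega : set 'rV[R]_n) : Prop :=
  forall x0 : 'rV[R]_n, boundary Omega x0 ->
    exists (i : 'I_n) (b : bool) (gamma : 'rV[R]_n.-1 -> R),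
      smooth_on setT gamma /\
      \forall x \near x0, Omega x <-> gamma (col' i x) < (-1) ^+ b * x 0 i.

(* C^oo of the closure: g is C^oo in Omega, g is continuous up to the boundary
   (with its own boundary values), and every partial derivative extends
   continuously to the closure. Values of g off the closure are irrelevant. *)
Definition smooth_closure n (Omega : set 'rV[R]_n) (g : 'rV[R]_n -> R) : Prop :=
  [/\ smooth_on Omega g,
      forall x, closure Omega x -> g @ within Omega (nbhs x) --> g x
    & forall (s : seq 'I_n) x, closure Omega x ->
        cvg (dpartial s g @ within Omega (nbhs x))].

Definition laplacian n (g : 'rV[R]_n -> R) (x : 'rV[R]_n) : R :=
  \sum_(i < n) dpartial [:: i; i] g x.

(* The Hessian at a point of the closure of Omega: its entries are the
   continuous extensions of the second derivatives from Omega. At points of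
   Omega this is the usual Hessian. *)
Definition hessian n (Omega : set 'rV[R]_n) (g : 'rV[R]_n -> R)
    (x : 'rV[R]_n) : 'M[R]_n :=
  \matrix_(i < n, j < n) lim (dpartial [:: i; j] g @ within Omega (nbhs x)).

Definition neg_semidef n (M : 'M[R]_n) : Prop :=
  forall v : 'rV[R]_n, (v *m M *m v^T) 0 0 <= 0.

Definition concave_function (E : lmodType R) (E' := convex_lmodType E)
    (D : set E') (g : E' -> R^o) : Prop :=
  forall t : {i01 R},
    {in D &, forall x y : E', g x <| t |> g y <= g (x <| t |> y)}.

End Defs.

(* Main.v *)
Require Import Defs.
From HB Require Import structures.
From mathcomp Require Import all_boot all_order all_algebra.
From mathcomp Require Import all_classical all_reals all_analysis.
From mathcomp Require Import ring lra.
Import Order.TTheory GRing.Theory Num.Theory.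
Import numFieldNormedType.Exports.

Set Implicit Arguments.
Unset Strict Implicit.
Unset Printing Implicit Defensive.

Local Open Scope classical_set_scope.
Local Open Scope ring_scope.

(* For a fixed direction v, differentiating the equation twice shows that
   w = D_v D_v u satisfies Delta w + f'(u) w = - f''(u) (D_v u)^2 >= 0.
   By concavity of f, for small d > 0 the positive function u + d is a strict
   supersolution of the same linear operator:
     (Delta + f'(u)) (u + d) = f'(u) u - f(u) + d f'(u)
                            <= - f(0) + d f'(0) < 0.
   If w were positive somewhere then, w being <= 0 on the boundary,
   w / (u + d) would attain a positive maximum t at an interior point, where
   w - t (u + d) is maximal and hence has nonpositive Laplacian, while
   its Laplacian is positive there.  So D^2 u <= 0 everywhere. *)

(** * Directional derivatives: restriction to lines, symmetry, maxima *)

Section DirectionalDerivatives.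
Context {R : realType} {V : normedModType R}.
Implicit Types (g : V -> R) (x y v w : V).

(** The quotients agree for every [h], so differentiating along [v] is differentiating in one
    variable on a line, with no regularity asked of [g]. *)
Lemma growth_rate_line g x v (t : R) :
  (fun h : R => h^-1 *: ((fun s : R => g (s *: v + x)) (h *: 1 + t) -
                         g (t *: v + x))) =
  (fun h : R => h^-1 *: (g (h *: v + (t *: v + x)) - g (t *: v + x))).
Proof.
by apply/funext => h; congr (_ *: (g _ - _)); rewrite scalerDl addrA [_%:A]mulr1.
Qed.

Lemma derive_line g x v (t : R) :
  'D_1 (fun s : R => g (s *: v + x)) t = 'D_v g (t *: v + x).
Proof. by rewrite /derive -growth_rate_line. Qed.

Lemma derivable_line g x v (t : R) :
  derivable (fun s : R => g (s *: v + x)) t 1 <-> derivable g (t *: v + x) v.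
Proof. by rewrite /derivable -growth_rate_line. Qed.

Lemma is_derive_line g x v (t a : R) :
  is_derive t 1 (fun s : R => g (s *: v + x)) a <->
  is_derive (t *: v + x) v g a.
Proof.
split=> -[dg <-]; split.
- exact/derivable_line.
- exact/esym/derive_line.
- exact/derivable_line.
- exact: derive_line.
Qed.

Lemma is_derive_real_comp (f : R -> R) g x v (a b : R) :
  is_derive (g x) 1 f a -> is_derive x v g b ->
  is_derive x v (f \o g) (a * b).
Proof.
move=> df dg; rewrite -[x]add0r -(scale0r v); apply/is_derive_line.
apply: (@is_derive1_comp _ f (fun s : R => g (s *: v + x))).
  by rewrite scale0r add0r.
by apply/is_derive_line; rewrite scale0r add0r.
Qed.

Lemma is_derive_scale_dir g x v (h : R) :
  derivable g x v -> is_derive x (h *: v) g (h * 'D_v g x).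
Proof.
move=> dg; rewrite -[x in is_derive x]add0r -(scale0r (h *: v)).
apply/is_derive_line.
rewrite (_ : (fun s : R => _) =
   (fun s : R => g (s *: v + x)) \o (fun s => s * h)); last first.
  by apply/funext => s /=; rewrite scalerA.
rewrite mulrC; apply: is_derive1_comp.
  by apply/is_derive_line; rewrite mul0r scale0r add0r; exact: derivableP.
apply: is_derive_eq.
by rewrite /= !scaler0 add0r [_%:A]mulr1.
Qed.

(** The one-variable theorem is used on [[0, 1]] in the direction [h *: v], so [h] may have either
    sign or vanish. *)
Lemma MVT_line g x v (h : R) :
  (forall t : R, 0 <= t <= 1 -> derivable g (x + (t * h) *: v) v) ->
  exists2 t : R, 0 <= t <= 1 &
    g (x + h *: v) - g x = h * 'D_v g (x + (t * h) *: v).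
Proof.
move=> dg.
have D (t : R) : 0 <= t <= 1 ->
    is_derive t 1 (fun s : R => g (s *: (h *: v) + x))
      (h * 'D_v g (x + (t * h) *: v)).
  move=> t01; apply/is_derive_line; rewrite scalerA addrC.
  exact/is_derive_scale_dir/dg.
have [] := @MVT_segment _ (fun s : R => g (s *: (h *: v) + x))
  (fun t => h * 'D_v g (x + (t * h) *: v)) 0 1 ler01.
- by move=> t; rewrite in_itv/= => /andP[/ltW t0 /ltW t1]; apply: D; rewrite t0.
- apply: derivable_within_continuous => t; rewrite in_itv/= => t01.
  by case: (D _ t01).
- move=> t; rewrite in_itv/= => t01.
  by rewrite subr0 mulr1 scale1r scale0r add0r (addrC _ x) => E; exists t.
Qed.

(** Every point of the parallelogram lies within [|h| (|v| + |w|)] of [x], so one bound on [h]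
    serves all [s] and [t]. *)
Lemma near_parallelogram x v w (P : V -> Prop) : (\forall y \near x, P y) ->
  \forall h \near (0 : R), forall s t : R, 0 <= s <= 1 -> 0 <= t <= 1 ->
    P (x + (s * h) *: v + (t * h) *: w).
Proof.
move=> /nbhs_ballP[e /= e0 eP].
have : \forall h \near (0 : R), `|h| * (`|v| + `|w|) < e.
  have /cvgrPdist_lt/(_ e e0) : (fun h : R => `|h| * (`|v| + `|w|)) @ 0 --> (0 : R).
    rewrite -[X in _ --> X](mul0r (`|v| + `|w|)) -{2}(normr0 R).
    by apply: cvgM; [apply: cvg_norm; exact: cvg_id|exact: cvg_cst].
  by apply: filterS => h /=; rewrite sub0r normrN ger0_norm// mulr_ge0 ?addr_ge0.
apply: filterS => h he s t /andP[s0 s1] /andP[t0 t1]; apply: eP.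
rewrite -ball_normE/= opprD opprD !addrA subrr sub0r -opprD normrN.
apply: le_lt_trans he; apply: le_trans (ler_normD _ _) _.
rewrite !normrZ mulrDr lerD// ler_wpM2r//.
  by rewrite ler_piMl// ger0_norm.
by rewrite ler_piMl// ger0_norm.
Qed.



Lemma is_derive_translate g x v c (a : R) :
  is_derive (x + c) v g a -> is_derive x v (fun y => g (y + c)) a.
Proof.
have E : (fun h : R =>
      h^-1 *: (((fun y => g (y + c)) \o shift x) (h *: v) - g (x + c)))
    = (fun h : R => h^-1 *: ((g \o shift (x + c)) (h *: v) - g (x + c))).
  by apply/funext => h /=; rewrite addrA.
by case=> D <-; split; rewrite /derivable /derive E.
Qed.

(* Only the derivative along v has to be continuous: g is first moved along w,
   at x, then along v, at points near x. *)
Lemma is_deriveD_dir g x v w (a : R) :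
  is_derive x w g a -> (\forall y \near x, derivable g y v) ->
  {for x, continuous ('D_v g)} -> is_derive x (w + v) g (a + 'D_v g x).
Proof.
move=> [dw <-] dv cv.
suff : (fun h : R => h^-1 *: ((g \o shift x) (h *: (w + v)) - g x)) @ 0^' -->
    'D_w g x + 'D_v g x.
  by move=> D; split; [apply/cvg_ex; eexists; exact: D|exact/cvg_lim].
rewrite (_ : (fun h : R => _) =
    (fun h => h^-1 *: ((g \o shift x) (h *: w) - g x)) \+
    (fun h => h^-1 *: (g (x + h *: w + h *: v) - g (x + h *: w)))); last first.
  apply/funext => h /=; rewrite -scalerDr; congr (_ *: _).
  have -> : h *: (w + v) + x = x + h *: w + h *: v.
    by rewrite scalerDr addrC addrA.
  by rewrite (addrC (h *: w) x) [RHS]addrC subrKA.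
apply: cvgD; first exact: dw.
apply/cvgrPdist_lt => e e0.
have /cvgrPdist_lt/(_ _ e0) cv' := cv.
have dcv : \forall y \near x, derivable g y v /\ `|'D_v g x - 'D_v g y| < e.
  exact: filterI.
have H := near_parallelogram w v dcv.
near=> h.
have h0 : h != 0 by near: h; exact: nbhs_dnbhs_neq.
have Hh : forall s t : R, 0 <= s <= 1 -> 0 <= t <= 1 ->
    derivable g (x + (s * h) *: w + (t * h) *: v) v /\
    `|'D_v g x - 'D_v g (x + (s * h) *: w + (t * h) *: v)| < e.
  by near: h; apply: nbhs_dnbhs; exact: H.
have l01 : 0 <= (1 : R) <= 1 by rewrite ler01 lexx.
have [|t t01 ->] := @MVT_line g (x + h *: w) v h.
  by move=> t t01; have [+ _] := Hh _ _ l01 t01; rewrite mul1r.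
have [_ +] := Hh _ _ l01 t01; rewrite mul1r.
by rewrite -[_ *: (h * _)]/(h^-1 * (h * _)) mulKf.
Unshelve. all: by end_near. Qed.

(* The left-hand side is symmetric in v and w, whence derive_comm. *)
Lemma parallelogram_mean g x v w (h : R) :
  (forall s t : R, 0 <= s <= 1 -> 0 <= t <= 1 ->
     derivable g (x + (s * h) *: v + (t * h) *: w) v /\
     derivable ('D_v g) (x + (s * h) *: v + (t * h) *: w) w) ->
  exists s t : R, [/\ 0 <= s <= 1, 0 <= t <= 1 &
    g (x + h *: v + h *: w) - g (x + h *: v) - (g (x + h *: w) - g x) =
    h * (h * 'D_w ('D_v g) (x + (s * h) *: v + (t * h) *: w))].
Proof.
move=> dg.
have l01 : 0 <= (1 : R) <= 1 by rewrite ler01 lexx.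
have l00 : 0 <= (0 : R) <= 1 by rewrite ler01 lexx.
(* The second difference is the increment of [phi] along [v]. The mean value theorem is applied to
   [phi] along [v], then to ['D_v g] along [w]. *)
pose phi y := g (y + h *: w) - g y.
have dphi (s : R) : 0 <= s <= 1 -> is_derive (x + (s * h) *: v) v phi
   ('D_v g (x + (s * h) *: v + h *: w) - 'D_v g (x + (s * h) *: v)).
  move=> s01; apply: is_deriveB.
    have [+ _] := dg _ _ s01 l01; rewrite mul1r => d.
    exact/is_derive_translate/derivableP.
  by apply: derivableP; have [+ _] := dg _ _ s01 l00; rewrite mul0r scale0r addr0.
have [s s01 Es] : exists2 s : R, 0 <= s <= 1 &
    phi (x + h *: v) - phi x = h * 'D_v phi (x + (s * h) *: v).
  by apply: (@MVT_line phi _ v) => s s01; case: (dphi _ s01).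
have [t t01 Et] : exists2 t : R, 0 <= t <= 1 &
    'D_v g (x + (s * h) *: v + h *: w) - 'D_v g (x + (s * h) *: v) =
    h * 'D_w ('D_v g) (x + (s * h) *: v + (t * h) *: w).
  apply: (@MVT_line ('D_v g) _ w) => t t01; exact: (dg _ _ s01 t01).2.
exists s, t; split => //; rewrite -Et; have [_ <-] := dphi _ s01.
exact: Es.
Qed.

(** If the two values [a] and [b] differed, then for small [h] both mixed derivatives would stay
    within [|a - b| / 2] of them on the parallelogram. Computing one second difference in both
    orders and cancelling [h] twice gives a common value of the two mixed derivatives, too close to
    both [a] and [b]. *)
Lemma derive_comm g x v w :
  (\forall y \near x, [/\ derivable g y v, derivable g y w,
     derivable ('D_v g) y w & derivable ('D_w g) y v]) ->
  {for x, continuous ('D_w ('D_v g))} -> {for x, continuous ('D_v ('D_w g))} ->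
  'D_w ('D_v g) x = 'D_v ('D_w g) x.
Proof.
move=> dg cvw cwv; apply/eqP/negPn/negP => neq.
set a : R := 'D_w ('D_v g) x in neq; set b : R := 'D_v ('D_w g) x in neq.
have e0 : 0 < `|a - b| / 2 by rewrite divr_gt0 ?normr_gt0 ?subr_eq0.
have /cvgrPdist_lt/(_ _ e0) Hv := cvw.
have /cvgrPdist_lt/(_ _ e0) Hw := cwv.
pose G y := [/\ derivable g y v, derivable g y w,
     derivable ('D_v g) y w & derivable ('D_w g) y v] /\
   (`|a - 'D_w ('D_v g) y| < `|a - b| / 2 /\
    `|b - 'D_v ('D_w g) y| < `|a - b| / 2).
have H : \forall y \near x, G y 
  by apply: filterI; [exact: dg|apply: filterI; [exact: Hv|exact: Hw]].
pose Q p q (h : R) := forall s t : R, 0 <= s <= 1 -> 0 <= t <= 1 ->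
  G (x + (s * h) *: p + (t * h) *: q).
have NQ p q : \forall h \near (0 : R)^', Q p q h.
  by apply: nbhs_dnbhs; exact: (near_parallelogram p q H).
have NQ2 : \forall h \near (0 : R)^', (h != 0) /\ (Q v w h /\ Q w v h).
  by apply: filterI; [exact: (@nbhs_dnbhs_neq R 0)|apply: filterI; exact: NQ].
have [h [h0 [{}Hv {}Hw]]] := filter_ex NQ2.
have [s [t [s01 t01 E1]]] : exists s t : R, [/\ 0 <= s <= 1, 0 <= t <= 1 &
    g (x + h *: v + h *: w) - g (x + h *: v) - (g (x + h *: w) - g x) =
    h * (h * 'D_w ('D_v g) (x + (s * h) *: v + (t * h) *: w))].
  apply: parallelogram_mean => s t s01 t01.
  by have [[d1 _ d2 _] _] := Hv _ _ s01 t01; split; [exact: d1|exact: d2].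
have [s' [t' [s'01 t'01 E2]]] : exists s t : R, [/\ 0 <= s <= 1, 0 <= t <= 1 &
    g (x + h *: w + h *: v) - g (x + h *: w) - (g (x + h *: v) - g x) =
    h * (h * 'D_v ('D_w g) (x + (s * h) *: w + (t * h) *: v))].
  apply: parallelogram_mean => s' t' s'01 t'01.
  by have [[_ d1 _ d2] _] := Hw _ _ s'01 t'01; split; [exact: d1|exact: d2].
have [_ [/= + _]] := Hv _ _ s01 t01.
have [_ [_ /= +]] := Hw _ _ s'01 t'01.
have -> : 'D_w ('D_v g) (x + (s * h) *: v + (t * h) *: w) =
    'D_v ('D_w g) (x + (s' * h) *: w + (t' * h) *: v).
  suff E : h * (h * 'D_w ('D_v g) (x + (s * h) *: v + (t * h) *: w)) =
      h * (h * 'D_v ('D_w g) (x + (s' * h) *: w + (t' * h) *: v)).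
    exact: (mulfI h0 (mulfI h0 E)).
  have aux (A B C D P Q' : R) :
      A - B - (C - D) = P -> A - C - (B - D) = Q' -> P = Q'.
    by move=> <- <-; ring.
  by move: E2; rewrite [x + h *: w + _]addrAC; exact: aux E1.
have close (c : R) : `|b - c| < `|a - b| / 2 -> `|a - c| < `|a - b| / 2 -> False.
  move=> cb ca; rewrite distrC in cb.
  have := le_lt_trans (ler_distD c a b) (ltrD ca cb).
  by rewrite -splitr ltxx.
exact: close.
Qed.

(** The first derivative along [v] vanishes at the maximum. Were the second one positive, the first
    would be positive just after [x], and [g] would rise above its maximum along the line. *)
Lemma derive2_le0_at_max g x v :
  (\forall y \near x, g y <= g x) -> (\forall y \near x, derivable g y v) ->
  derivable ('D_v g) x v -> 'D_v ('D_v g) x <= 0.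
Proof.
move=> gmax dg ddg; rewrite leNgt; apply/negP => a0.
have cx : (fun s : R => s *: v + x) @ 0 --> x.
  have {2}-> : x = 0 *: v + x by rewrite scale0r add0r.
  by apply: cvgD; [apply: cvgZ; [exact: cvg_id|exact: cvg_cst]|exact: cvg_cst].
pose psi (s : R) := g (s *: v + x).
have [e /= e0 He] : exists2 e : R, 0 < e & forall s : R, `|s| < e ->
    psi s <= psi 0 /\ derivable psi s 1.
  have gmaxd : \forall y \near x, g y <= g x /\ derivable g y v by exact: filterI.
  have near0 : \forall s \near (0 : R), psi s <= psi 0 /\ derivable psi s 1.
    have : \forall s \near (0 : R),
        g (s *: v + x) <= g x /\ derivable g (s *: v + x) v := cx _ gmaxd.
    apply: filterS => s [gs ds]; split; last exact/derivable_line.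
    by rewrite /psi scale0r add0r.
  have /nbhs_ballP[e /= e0 He] := near0; exists e; first exact: e0.
  move=> s se.
  by apply: He; rewrite -ball_normE/= sub0r normrN.
have He' s : s \in `]-e, e[ -> psi s <= psi 0 /\ derivable psi s 1.
  by rewrite in_itv/= => se; apply: He; rewrite ltr_norml.
have D0 : 'D_v g x = 0.
  have [||||_] := @derive1_at_max _ psi (- e) e 0.
  - by rewrite ge0_cp// ltW.
  - by move=> t /He'[].
  - by rewrite in_itv/= oppr_lt0 e0.
  - by move=> t /He'[].
  - by rewrite derive_line scale0r add0r.
have [d /= d0 Hd] : exists2 d : R, 0 < d & forall s : R, 0 < s < d ->
    0 < 'D_1 psi s.
  have : \forall h \near (0 : R)^',
      0 < h^-1 *: (('D_v g \o shift x) (h *: v) - 'D_v g x).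
    by apply: cvgr_gt a0; exact: ddg.
  move=> /nbhs_ballP[d /= d0 Hd]; exists d => // s /andP[s0 sd].
  have := Hd s; rewrite -ball_normE/= sub0r normrN gtr0_norm// => /(_ sd).
  move=> /(_ (lt0r_neq0 s0)); rewrite D0 subr0 derive_line.
  by rewrite [_ *: _]/(_ * _) pmulr_rgt0// invr_gt0.
(* Halving puts [h] strictly inside both radii: [e], where [psi] is below [psi 0], and [d], where
   its derivative is positive. *)
pose h := Num.min d e / 2.
have m0 : 0 < Num.min d e by rewrite lt_min d0.
have h0 : 0 < h by rewrite divr_gt0.
have hd : h < Num.min d e by rewrite ltr_pdivrMr// ltr_pMr// ltr1n.
have [hd' he'] : h < d /\ h < e by move: hd; rewrite lt_min => /andP[].
have psid s : s \in `[0, h] -> derivable psi s 1.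
  rewrite in_itv/= => /andP[s0 sh]; apply: (He s _).2.
  by rewrite ger0_norm// (le_lt_trans sh).
have [||c] := @MVT _ psi ('D_1 psi) 0 h h0.
- move=> s s0h; apply: derivableP; apply: psid; exact: subset_itv_oo_cc.
- exact: derivable_within_continuous.
rewrite in_itv/= subr0 => /andP[c0 ch] E.
have : 0 < psi h - psi 0 by rewrite E mulr_gt0// Hd// c0 (lt_trans ch).
by rewrite subr_gt0 ltNge (He h _).1// gtr0_norm.
Qed.

End DirectionalDerivatives.

(** * Calculus of smooth functions on an open set *)

Lemma near_open (T : topologicalType) (A : set T) (x : T) :
  open A -> A x -> \forall y \near x, A y.
Proof. by move=> oA Ax; exact: open_nbhs_nbhs. Qed.

Lemma cvg_lincomb (R : realType) (T : Type) (F : set_system T) (FF : Filter F)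
    (I : finType) (c : I -> R) (H : I -> T -> R) (l : I -> R) :
  (forall k, H k @ F --> l k) ->
  (fun y => \sum_k c k * H k y) @ F --> \sum_k c k * l k.
Proof.
move=> Hl; elim: (index_enum I) => [|k r IH].
  rewrite big_nil; under eq_fun do rewrite big_nil; exact: cvg_cst.
rewrite big_cons; under eq_fun do rewrite big_cons.
by apply: cvgD IH; apply: cvgM; [exact: cvg_cst|exact: Hl].
Qed.

Section SmoothFunctions.
Context {R : realType} {n : nat} (Omega : set 'rV[R]_n).
Hypothesis Omega_open : open Omega.
Implicit Types (g h : 'rV[R]_n -> R) (s : seq 'I_n) (x v : 'rV[R]_n).

Lemma near_eq_continuous g h x : (\forall y \near x, g y = h y) ->
  {for x, continuous g} -> {for x, continuous h}.
Proof.
move=> gh cg; rewrite /prop_for /continuous_at -(nbhs_singleton gh).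
by apply: cvg_trans cg; exact: (@near_eq_cvg _ _ (nbhs x) _ g h gh).
Qed.

Lemma eq_dpartial g h : (forall x, Omega x -> g x = h x) ->
  forall s x, Omega x -> dpartial s g x = dpartial s h x.
Proof.
move=> gh; elim=> [|i s IH] x Ox /=; first exact: gh.
by apply: near_eq_derive; apply: filterS (near_open Omega_open Ox) => y /IH.
Qed.

Lemma dpartial_cat s1 s2 g : dpartial (s1 ++ s2) g = dpartial s1 (dpartial s2 g).
Proof. exact: foldr_cat. Qed.

Lemma smooth_on_dpartial s g : smooth_on Omega g -> smooth_on Omega (dpartial s g).
Proof. by move=> gs s' x Ox; rewrite -dpartial_cat; exact: gs. Qed.

Lemma smooth_on_continuous g x :
  smooth_on Omega g -> Omega x -> {for x, continuous g}.
Proof. by move=> gs Ox; exact: (gs [::] x Ox).1. Qed.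

Lemma smooth_on_is_derive i g x : smooth_on Omega g -> Omega x ->
  is_derive x (delta_mx 0 i) g (partial i g x).
Proof. by move=> gs Ox; apply: derivableP; exact: (gs [::] x Ox).2. Qed.

Lemma eq_smooth_on g h : (forall x, Omega x -> g x = h x) ->
  smooth_on Omega g -> smooth_on Omega h.
Proof.
move=> gh gs s x Ox; have [cg dg] := gs s x Ox.
have E : \forall y \near x, dpartial s g y = dpartial s h y.
  by apply: filterS (near_open Omega_open Ox) => y; exact: eq_dpartial.
split; first exact: near_eq_continuous cg.
by move=> i; exact: near_eq_derivable (dg i).
Qed.

Lemma partialC i j g x : smooth_on Omega g -> Omega x ->
  partial i (partial j g) x = partial j (partial i g) x.
Proof.
move=> gs Ox; apply: derive_comm.
- apply: filterS (near_open Omega_open Ox) => y Oy; split.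
  + exact: (gs [::] y Oy).2.
  + exact: (gs [::] y Oy).2.
  + exact: (gs [:: j] y Oy).2.
  + exact: (gs [:: i] y Oy).2.
- exact: (gs [:: i; j] x Ox).1.
- exact: (gs [:: j; i] x Ox).1.
Qed.

Lemma dpartialC s1 i j s2 g x : smooth_on Omega g -> Omega x ->
  dpartial (s1 ++ i :: j :: s2) g x = dpartial (s1 ++ j :: i :: s2) g x.
Proof.
move=> gs Ox; rewrite 2!(dpartial_cat s1); apply: (eq_dpartial _ _ Ox) => y Oy.
exact: (partialC i j (smooth_on_dpartial s2 gs) Oy).
Qed.

(** Four swaps of adjacent indices; this lets the Laplacian pass through the second derivatives of
    [u]. *)
Lemma dpartial_pairsC i j k g x : smooth_on Omega g -> Omega x ->
  dpartial [:: k; k; i; j] g x = dpartial [:: i; j; k; k] g x.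
Proof.
move=> gs Ox.
transitivity (dpartial [:: k; i; k; j] g x).
  exact: (dpartialC [:: k] k i [:: j] gs Ox).
transitivity (dpartial [:: i; k; k; j] g x).
  exact: (dpartialC [::] k i [:: k; j] gs Ox).
transitivity (dpartial [:: i; k; j; k] g x).
  exact: (dpartialC [:: i; k] k j [::] gs Ox).
exact: (dpartialC [:: i] k j [:: k] gs Ox).
Qed.

Section LinearCombination.
Context (I : finType) (c : I -> R) (G : I -> 'rV[R]_n -> R).
Hypothesis G_smooth : forall k, smooth_on Omega (G k).

Lemma is_derive_lincomb (H : I -> 'rV[R]_n -> R) (dH : I -> R) x v :
  (forall k, is_derive x v (H k) (dH k)) ->
  is_derive x v (fun y => \sum_k c k * H k y) (\sum_k c k * dH k).
Proof.
move=> dHk; elim: (index_enum I) => [|k r IH].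
  rewrite big_nil; under eq_fun do rewrite big_nil; exact: is_derive_cst.
rewrite big_cons; under eq_fun do rewrite big_cons.
by apply: is_deriveD; exact: is_deriveZ.
Qed.

(** Arbitrary finite index types let one statement cover directional derivatives (sums over ['I_n]),
    Hessian forms (sums over pairs), negation (one term) and combinations of two functions (sums
    over [bool]). *)
Lemma dpartial_lincomb s x : Omega x ->
  dpartial s (fun y => \sum_k c k * G k y) x = \sum_k c k * dpartial s (G k) x.
Proof.
elim: s x => [//|i s IH] x Ox /=.
rewrite /partial (near_eq_derive (g := fun y => \sum_k c k * dpartial s (G k) y)).
  have [_ ->//] := @is_derive_lincomb (fun k => dpartial s (G k)) _ x
    (delta_mx 0 i) (fun k => smooth_on_is_derive i (smooth_on_dpartial s (G_smooth k)) Ox).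
by apply: filterS (near_open Omega_open Ox) => y /IH.
Qed.

Lemma smooth_on_lincomb : smooth_on Omega (fun y => \sum_k c k * G k y).
Proof.
move=> s x Ox.
have E : \forall y \near x, \sum_k c k * dpartial s (G k) y =
    dpartial s (fun y => \sum_k c k * G k y) y.
  by apply: filterS (near_open Omega_open Ox) => y Oy; rewrite dpartial_lincomb.
split.
  apply: near_eq_continuous E _; apply: (@cvg_lincomb R _ (nbhs x)) => k.
  exact: (G_smooth k s Ox).1.
move=> i; apply: near_eq_derivable E _.
have [+ _] := @is_derive_lincomb (fun k => dpartial s (G k)) _ x
    (delta_mx 0 i) (fun k => smooth_on_is_derive i (smooth_on_dpartial s (G_smooth k)) Ox).
exact.
Qed.

End LinearCombination.

Lemma dpartialN g s x : smooth_on Omega g -> Omega x ->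
  dpartial s (fun y => - g y) x = - dpartial s g x.
Proof.
move=> gs Ox; have -> : (fun y => - g y) = (fun y => \sum_(k < 1) -1 * g y).
  by apply/funext => y; rewrite big_ord1 mulN1r.
by rewrite (dpartial_lincomb _ (fun=> gs) s Ox) big_ord1 mulN1r.
Qed.

Lemma smooth_onN g : smooth_on Omega g -> smooth_on Omega (fun y => - g y).
Proof.
move=> gs; have -> : (fun y => - g y) = (fun y => \sum_(k < 1) -1 * g y).
  by apply/funext => y; rewrite big_ord1 mulN1r.
exact: (smooth_on_lincomb _ (fun=> gs)).
Qed.

(** The coordinates of [v] are added one at a time by [is_deriveD_dir]; continuity of the partial
    derivatives is enough, and total differentiability is never invoked. *)
Lemma smooth_on_derive g x v : smooth_on Omega g -> Omega x ->
  is_derive x v g (\sum_i v 0 i * partial i g x).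
Proof.
move=> gs Ox; rewrite {1}(row_sum_delta v).
elim: (index_enum 'I_n) => [|i r IH]; first by rewrite !big_nil; exact: is_derive0.
have dg y : Omega y ->
    is_derive y (v 0 i *: delta_mx 0 i) g (v 0 i * partial i g y).
  by move=> Oy; exact: is_derive_scale_dir ((gs [::] y Oy).2 i).
rewrite !big_cons addrC [X in is_derive _ _ _ X]addrC.
have [_ <-] := dg x Ox; apply: (is_deriveD_dir IH).
  by apply: filterS (near_open Omega_open Ox) => y /dg[].
apply: (@near_eq_continuous (fun y => v 0 i * partial i g y)).
  by apply: filterS (near_open Omega_open Ox) => y /dg[].
by apply: (@cvgM _ _ (nbhs x)); [exact: cvg_cst|exact: (gs [:: i] x Ox).1].
Qed.

End SmoothFunctions.

(** The derivative of [f] is nonincreasing on [[0, M]]; the second bound follows since [f s - f 0]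
    is [s] times a slope at some [c <= s]. Together they make [u + d] a strict supersolution. *)
Lemma concave_above_tangent (R : realType) (f : R -> R) (M : R) :
  smooth_real f ->
  (forall s, 0 <= s <= M -> (f^`(2))%classic s <= 0) ->
  forall s, 0 <= s <= M ->
    (f^`())%classic s <= (f^`())%classic 0 /\
    f 0 <= f s - (f^`())%classic s * s.
Proof.
move=> fs f2.
have df (x : R) : is_derive x 1 f ((f^`())%classic x).
  by rewrite derive1E; apply: derivableP; exact: (fs 0 x).
have ddf (x : R) : is_derive x 1 (f^`())%classic ((f^`(2))%classic x).
  by rewrite derive1nS derive1n1 derive1E; apply: derivableP; exact: (fs 1 x).
have decr (a b : R) : 0 <= a -> a <= b -> b <= M ->
    (f^`())%classic b <= (f^`())%classic a.
  move=> a0 ab bM.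
  have [|c] := @MVT_segment _ _ _ a b ab (fun x _ => ddf x).
    by apply: derivable_within_continuous => x _; case: (ddf x).
  rewrite in_itv/= => /andP[ac cb] E.
  rewrite -subr_le0 E mulr_le0_ge0 ?subr_ge0// f2// (le_trans a0 ac)/=.
  exact: le_trans bM.
move=> s /andP[s0 sM]; split; first exact: decr.
have [|c] := @MVT_segment _ _ _ 0 s s0 (fun x _ => df x).
  by apply: derivable_within_continuous => x _; case: (df x).
rewrite in_itv/= subr0 => /andP[c0 cs] E.
have : (f^`())%classic s * s <= (f^`())%classic c * s.
  by rewrite ler_wpM2r// decr.
by rewrite -E; lra.
Qed.

(** * Maximum principle and the equation for the Hessian form *)

Section MaximumPrinciple.
Context {R : realType} {n : nat} (Omega : set 'rV[R]_n).
Hypothesis Omega_open : open Omega.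
Hypothesis Omega_bounded : bounded_set Omega.
Implicit Types (g h u : 'rV[R]_n -> R) (x v p : 'rV[R]_n).

(** The superlevel set [K] is closed in the whole space, because [g < c] near the boundary keeps its
    limit points inside [Omega]. Being bounded it is compact, and a maximum over [K] is one over
    [Omega]. Values of [g] on the boundary never enter. *)
Lemma attained_max g (c : R) x1 :
  (forall x, Omega x -> {for x, continuous g}) ->
  (forall p, boundary Omega p -> \forall y \near within Omega (nbhs p), g y < c) ->
  Omega x1 -> c <= g x1 ->
  exists x0, [/\ Omega x0, c <= g x0 & forall y, Omega y -> g y <= g x0].
Proof.
move=> cg bg Ox1 cx1; pose K := [set x | Omega x /\ c <= g x].
have K_closed : closed K.
  move=> p clp.
  have clOp : closure Omega p.
    by move=> B /clp[y [[Oy _] By]]; exists y.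
  have [Op|nOp] := pselect (Omega p).
    split => //; rewrite leNgt; apply/negP => gpc.
    have : \forall y \near p, g y < c.
      exact: (@cvgr_lt _ _ (nbhs p) _ g (g p) (cg p Op) c gpc).
    by move=> /clp[y [[_ cy] /= yc]]; move: (le_lt_trans cy yc); rewrite ltxx.
  have bp : boundary Omega p by split => // /interior_subset.
  have /clp[y [[Oy cy] /= yc]] := bg p bp.
  by have := le_lt_trans cy (yc Oy); rewrite ltxx.
have K_compact : compact K.
  apply: bounded_closed_compact K_closed.
  have [M [Mreal OM]] := Omega_bounded.
  by exists M; split => // k Mk y [Oy _]; exact: OM Mk y Oy.
have [|||] := @EVT_max_rV _ _ g K.
- by exists x1.
- exact: K_compact.
- by apply: continuous_in_subspaceT => x; rewrite inE => -[Ox _]; exact: cg.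
move=> x0; rewrite inE => -[Ox0 cx0] mx0; exists x0; split => // y Oy.
have [cy|yc] := leP c (g y); first by apply: mx0; rewrite inE.
exact: le_trans (ltW yc) cx0.
Qed.

Lemma laplacian_le0_at_max g x0 : smooth_on Omega g -> Omega x0 ->
  (forall y, Omega y -> g y <= g x0) -> laplacian g x0 <= 0.
Proof.
move=> gs Ox0 gmax; apply: sumr_le0 => i _; apply: derive2_le0_at_max.
- exact: filterS (near_open Omega_open Ox0).
- by apply: filterS (near_open Omega_open Ox0) => y Oy; exact: (gs [::] y Oy).2.
- exact: (gs [:: i] x0 Ox0).2.
Qed.

Lemma laplacian_lincomb (I : finType) (c : I -> R) (G : I -> 'rV[R]_n -> R) x :
  (forall k, smooth_on Omega (G k)) -> Omega x ->
  laplacian (fun y => \sum_k c k * G k y) x = \sum_k c k * laplacian (G k) x.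
Proof.
move=> Gs Ox.
transitivity (\sum_i \sum_k c k * dpartial [:: i; i] (G k) x).
  by apply: eq_bigr => i _; exact: (dpartial_lincomb Omega_open c Gs [:: i; i] Ox).
by rewrite exchange_big; apply: eq_bigr => k _; rewrite mulr_sumr.
Qed.

Lemma smooth_on_laplacian2 (a b : R) g h :
  smooth_on Omega g -> smooth_on Omega h ->
  smooth_on Omega (fun y => a * g y + b * h y) /\
  forall x, Omega x -> laplacian (fun y => a * g y + b * h y) x =
    a * laplacian g x + b * laplacian h x.
Proof.
move=> gs hs; pose c (k : bool) := if k then a else b.
pose G (k : bool) := if k then g else h.
have Gs k : smooth_on Omega (G k) by case: k; [exact: gs|exact: hs].
have <- : (fun y => \sum_k c k * G k y) = (fun y => a * g y + b * h y).
  by apply/funext => y; rewrite big_bool.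
split; first exact: smooth_on_lincomb.
by move=> x Ox; rewrite laplacian_lincomb// big_bool.
Qed.

(** A negative value would give [- u] an interior maximum, where its Laplacian is at most 0; the
    strict inequality forbids this. *)
Lemma superharmonic_ge0 u : smooth_on Omega u ->
  (forall p, boundary Omega p -> u y @[y --> within Omega (nbhs p)] --> (0 : R)) ->
  (forall x, Omega x -> laplacian u x < 0) ->
  forall x, Omega x -> 0 <= u x.
Proof.
move=> us u0 uL x1 Ox1; rewrite leNgt; apply/negP => ux1.
have gs := smooth_onN Omega_open us.
have [|||x0 [Ox0 _ gmax]] := @attained_max (fun y => - u y) (- u x1) x1 _ _ Ox1.
- by move=> x Ox; exact: smooth_on_continuous gs Ox.
- move=> p bp; have : \forall y \near within Omega (nbhs p), u x1 < u y.
    by apply: cvgr_gt ux1; exact: u0.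
  by apply: filterS => y; rewrite ltrN2.
- exact: lexx.
have := laplacian_le0_at_max gs Ox0 gmax.
have -> : laplacian (fun y => - u y) x0 = - laplacian u x0.
  rewrite /laplacian -sumrN; apply: eq_bigr => k _.
  exact: (dpartialN Omega_open [:: k; k] us Ox0).
by rewrite oppr_le0 leNgt uL.
Qed.

(** The quadratic form of the Hessian, flattened to a sum over pairs so that the lemmas on linear
    combinations apply. On [Omega] it is the second derivative along [v], by [derive2E]. *)
Definition hessian_form v u x : R :=
  \sum_(k : 'I_n * 'I_n) (v 0 k.1 * v 0 k.2) * dpartial [:: k.1; k.2] u x.

Lemma eq_hessian_form v g h x : (forall y, Omega y -> g y = h y) -> Omega x ->
  hessian_form v g x = hessian_form v h x.
Proof.
move=> gh Ox; apply: eq_bigr => k _.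
by rewrite (eq_dpartial Omega_open gh [:: k.1; k.2] Ox).
Qed.

Lemma smooth_on_hessian_form v u :
  smooth_on Omega u -> smooth_on Omega (hessian_form v u).
Proof.
move=> us; exact: (smooth_on_lincomb Omega_open
  (fun k => v 0 k.1 * v 0 k.2) (fun k => smooth_on_dpartial [:: k.1; k.2] us)).
Qed.

Lemma hessian_form_boundary v u p :
  (forall i j, cvg (dpartial [:: i; j] u @ within Omega (nbhs p))) ->
  hessian_form v u y @[y --> within Omega (nbhs p)] -->
    (v *m hessian Omega u p *m v^T) 0 0.
Proof.
move=> cu.
have -> : (v *m hessian Omega u p *m v^T) 0 0 =
   \sum_(k : 'I_n * 'I_n) (v 0 k.1 * v 0 k.2) *
     lim (dpartial [:: k.1; k.2] u @ within Omega (nbhs p)).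
  rewrite mxE; under eq_bigr do rewrite !mxE mulr_suml.
  rewrite exchange_big pair_bigA; apply: eq_bigr => -[i j] _ /=.
  by rewrite !mxE mulrAC.
by apply: (@cvg_lincomb R _ (within Omega (nbhs p))) => k; exact: cu.
Qed.

Lemma derive2E u v x : smooth_on Omega u -> Omega x ->
  derivable u x v /\ is_derive x v ('D_v u) (hessian_form v u x).
Proof.
move=> us Ox; split; first by case: (smooth_on_derive Omega_open v us Ox).
have [d E] := smooth_on_derive Omega_open v
  (smooth_on_lincomb Omega_open (fun i => v 0 i)
    (fun i => smooth_on_dpartial [:: i] us)) Ox.
apply: (@near_eq_is_derive _ _ _ (fun y => \sum_i v 0 i * dpartial [:: i] u y)).
  apply: filterS (near_open Omega_open Ox) => y Oy.
  by have [_ ->] := smooth_on_derive Omega_open v us Oy.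
split; first exact: d.
rewrite E /hessian_form -(pair_bigA _
  (fun i j => v 0 i * v 0 j * dpartial [:: i; j] u x)).
apply: eq_bigr => i _.
rewrite -[partial i _ x]/(dpartial [:: i] _ x).
rewrite (dpartial_lincomb Omega_open _ (fun i => smooth_on_dpartial [:: i] us) _ Ox).
by rewrite mulr_sumr; apply: eq_bigr => j _; rewrite mulrA.
Qed.

(** Both operators have constant coefficients, so they commute by symmetry of the partial
    derivatives. *)
Lemma laplacian_hessian_form v u x : smooth_on Omega u -> Omega x ->
  laplacian (hessian_form v u) x = hessian_form v (laplacian u) x.
Proof.
move=> us Ox.
rewrite (laplacian_lincomb _
  (fun k => smooth_on_dpartial [:: k.1; k.2] us) Ox).
apply: eq_bigr => -[i j] _ /=; congr (_ * _).
rewrite /laplacian.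
transitivity (\sum_k 1 * dpartial [:: i; j] (dpartial [:: k; k] u) x).
  apply: eq_bigr => k _; rewrite mul1r.
  exact: (dpartial_pairsC Omega_open i j k us Ox).
rewrite -(dpartial_lincomb Omega_open _ (fun k => smooth_on_dpartial [:: k; k] us) _ Ox).
congr (dpartial [:: i; j] _ x); apply/funext => y.
by apply: eq_bigr => k _; rewrite mul1r.
Qed.

Lemma hessian_form_comp v (f : R -> R) u x :
  smooth_real f -> smooth_on Omega u -> Omega x ->
  hessian_form v (f \o u) x =
    (f^`(2))%classic (u x) * (\sum_i v 0 i * partial i u x) ^+ 2 +
    (f^`())%classic (u x) * hessian_form v u x.
Proof.
move=> fs us Ox.
have df (s : R) : is_derive s 1 f ((f^`())%classic s).
  by rewrite derive1E; apply: derivableP; exact: (fs 0 s).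
have ddf (s : R) : is_derive s 1 (f^`())%classic ((f^`(2))%classic s).
  by rewrite derive1nS derive1n1 derive1E; apply: derivableP; exact: (fs 1 s).
have d1 j y : Omega y ->
    partial j (f \o u) y = ((f^`())%classic \o u) y * partial j u y.
  move=> Oy; have [_] := is_derive_real_comp (df (u y)) (smooth_on_is_derive j us Oy).
  exact.
have d2 i j : dpartial [:: i; j] (f \o u) x =
    (f^`(2))%classic (u x) * (partial i u x * partial j u x) +
    (f^`())%classic (u x) * dpartial [:: i; j] u x.
  (* [d1] holds on all of the open set [Omega], so it may be differentiated once more. *)
  have /= -> := eq_dpartial Omega_open (d1 j) [:: i] Ox.
  have D1 := is_derive_real_comp (ddf (u x)) (smooth_on_is_derive i us Ox).
  have D2 := smooth_on_is_derive i (smooth_on_dpartial [:: j] us) Ox.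
  have [_ E] := is_deriveM D1 D2; apply: (etrans E).
  rewrite /GRing.scale/= addrC mulrC -mulrA; congr (_ * _ + _).
rewrite expr2 mulr_suml; under [in RHS]eq_bigr do rewrite mulr_sumr.
rewrite pair_bigA !mulr_sumr -big_split; apply: eq_bigr => -[i j] _.
rewrite (d2 i j) /=; ring.
Qed.

Lemma hessian_form_le0 v (f : R -> R) (M : R) u :
  smooth_real f -> 0 < f 0 ->
  (forall s, 0 <= s <= M -> (f^`(2))%classic s <= 0) ->
  smooth_on Omega u ->
  (forall x, Omega x -> - laplacian u x = f (u x)) ->
  (forall x, Omega x -> 0 <= u x <= M) ->
  (forall p, boundary Omega p -> exists2 L : R, L <= 0 &
     hessian_form v u y @[y --> within Omega (nbhs p)] --> L) ->
  forall x, Omega x -> hessian_form v u x <= 0.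
Proof.
(* Maximality of the quotient becomes maximality of [w - t u]: the constant [t d] cancels, and so
   need not be carried through the Laplacian. *)
have max_sub (r e a b a' b' : R) : a <= r * (b + e) -> a' = r * (b' + e) ->
    1 * a + - r * b <= 1 * a' + - r * b'.
  by move=> + ->; lra.
(* Read [r = t], [s = u x0], [e = d], [k] and [k0] as the slopes of [f] at [u x0] and 0,
   [fs' = f (u x0)], [f0' = f 0], and [q] as the second derivative of [f] times the squared
   derivative of [u] along [v]. The last premise bounds the Laplacian of [w - t u] at [x0]. *)
have final (r s e q k k0 fs' f0' : R) : k <= k0 -> f0' <= fs' - k * s ->
    k0 * e < f0' -> q <= 0 -> 0 < e -> 0 < r ->
    - q + - k * (r * (s + e)) + - r * - fs' <= 0 -> False.
  move=> kk0 tn ke q0 e0 r0; rewrite leNgt => /negP; apply.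
  have : k * e <= k0 * e by rewrite ler_wpM2r// ltW.
  have : 0 < r * (fs' - k * s - k * e) ->
    0 < - q + - k * (r * (s + e)) + - r * - fs' by lra.
  move=> + ?; apply; rewrite mulr_gt0//; lra.
move=> fs f0 f2 us uL uM wb x1 Ox1; rewrite leNgt; apply/negP => w1.
set w := hessian_form v u in wb w1.
have ws : smooth_on Omega w by exact: smooth_on_hessian_form.
have tangent := concave_above_tangent fs f2.
(* Small enough that the slope of [f] at 0 times [d] stays below [f 0]; the [+ 1] makes this strict
   and the denominator nonzero. *)
pose d := f 0 / (`|(f^`())%classic 0| + 1).
have d0 : 0 < d by rewrite divr_gt0// ltr_wpDl.
have df0 : (f^`())%classic 0 * d < f 0.
  have E : d * (`|(f^`())%classic 0| + 1) = f 0.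
    by rewrite /d divfK// lt0r_neq0// ltr_wpDl.
  have : (f^`())%classic 0 * d <= `|(f^`())%classic 0| * d.
    by rewrite ler_wpM2r ?(ltW d0)// ler_norm.
  lra.
have h0 x : Omega x -> 0 < u x + d.
  by move=> Ox; have /andP[u0 _] := uM x Ox; rewrite ltr_wpDl.
pose g x := w x / (u x + d).
have c0 : 0 < g x1 by rewrite divr_gt0 ?h0.
have [|||x0 [Ox0 cx0 gmax]] := @attained_max g (g x1) x1 _ _ Ox1.
- move=> x Ox; apply: (@cvgM _ _ (nbhs x)).
    exact: smooth_on_continuous ws Ox.
  apply: (@cvgV _ _ (nbhs x)); first exact: lt0r_neq0 (h0 x Ox).
  apply: (@cvgD _ _ _ (nbhs x)); last exact: cvg_cst.
  exact: smooth_on_continuous us Ox.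
- move=> p bp; have [L L0 wL] := wb p bp.
  (* Near the boundary [w < g x1 * d <= g x1 * (u + d)], as [u >= 0]; hence [g < g x1] there. *)
  have Lc : L < g x1 * d by apply: le_lt_trans L0 _; exact: mulr_gt0.
  have near_w : \forall y \near within Omega (nbhs p), w y < g x1 * d.
    exact: (@cvgr_lt _ _ (within Omega (nbhs p)) _ w L wL _ Lc).
  have near_O : \forall y \near within Omega (nbhs p), Omega y by exact: withinT.
  apply: (@filterS2 _ _ (within_filter _ (nbhs_filter p))
    _ _ _ _ near_w near_O) => y wy Oy.
  have /andP[u0 _] := uM y Oy.
  rewrite /g ltr_pdivrMr ?h0//; apply: lt_le_trans wy _.
  by rewrite ler_pM2l// lerDr.
- exact: lexx.
set t := g x0 in cx0 gmax; have t0 : 0 < t := lt_le_trans c0 cx0.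
have wE : w x0 = t * (u x0 + d) by rewrite /t /g divfK// lt0r_neq0// h0.
have [phis phiL] := smooth_on_laplacian2 1 (- t) ws us.
have phimax y : Omega y -> 1 * w y + - t * u y <= 1 * w x0 + - t * u x0.
  move=> Oy; apply: max_sub wE; rewrite -ler_pdivrMr ?h0//; exact: gmax.
have := laplacian_le0_at_max phis Ox0 phimax.
rewrite (phiL x0 Ox0) mul1r.
(* The equation reads [laplacian u = F \o u], so the chain rule for Hessian forms is applied to
   [F]. *)
pose F (s : R) := - f s.
have FE k : (F^`(k))%classic = (fun s => - (f^`(k))%classic s).
  elim: k => [//|k IH]; rewrite derive1nS IH; apply/funext => s.
  by rewrite (derive1N (fs k s)) -derive1nS.
have Fs : smooth_real F by move=> k s; rewrite FE; exact/derivableN/fs.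
have lapF x : Omega x -> laplacian u x = (F \o u) x.
  by move=> Ox; rewrite /= /F -uL// opprK.
have -> : laplacian w x0 = hessian_form v (F \o u) x0.
  apply: etrans (laplacian_hessian_form v us Ox0) _.
  exact: eq_hessian_form lapF Ox0.
rewrite (hessian_form_comp v Fs us Ox0) (lapF x0 Ox0) -/w wE.
rewrite FE -(derive1n1 F) FE derive1n1 /= /F.
have [f's tan] := tangent _ (uM x0 Ox0).
have q0 := mulr_le0_ge0 (f2 _ (uM x0 Ox0))
  (sqr_ge0 (\sum_i v 0 i * partial i u x0)).
rewrite mulNr; exact: final f's tan df0 q0 d0 t0.
Qed.

End MaximumPrinciple.

(** * From the sign of the Hessian form to concavity *)

Lemma le_sup_closure (R : realType) (n : nat) (Omega : set 'rV[R]_n)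
    (u : 'rV[R]_n -> R) : open Omega -> bounded_set Omega -> smooth_on Omega u ->
  (forall p, boundary Omega p -> u y @[y --> within Omega (nbhs p)] --> (0 : R)) ->
  (forall p, boundary Omega p -> u p = 0) ->
  forall x, Omega x -> u x <= sup [set u y | y in closure Omega].
Proof.
move=> oO bO us u0 u0p x Ox.
have [M HM] : exists M : R, forall y, closure Omega y -> u y <= M.
  (* The supremum is an upper bound only once the values are bounded: by an interior maximum if [u]
     is positive somewhere, by 0 otherwise. *)
  have [[z [Oz uz]]|npos] := pselect (exists z, Omega z /\ 0 < u z); last first.
    exists 0 => y cy; have [Oy|nOy] := pselect (Omega y).
      by rewrite leNgt; apply/negP => uy; apply: npos; exists y.
    by rewrite u0p//; split => // /interior_subset.
  have [|||x0 [Ox0 zx0 mx0]] := @attained_max _ _ _ bO u (u z) z _ _ Oz.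
  - by move=> y Oy; exact: smooth_on_continuous us Oy.
  - move=> p bp.
    exact: (@cvgr_lt _ _ (within Omega (nbhs p)) _ u 0 (u0 p bp) _ uz).
  - exact: lexx.
  exists (u x0) => y cy; have [Oy|nOy] := pselect (Omega y); first exact: mx0.
  have -> : u y = 0 by apply: u0p; split => // /interior_subset.
  exact: ltW (lt_le_trans uz zx0).
apply: ub_le_sup; last by exists x => //; exact: subset_closure.
by exists M => _ [y cy <-]; exact: HM.
Qed.

(** On each segment [- u] has a nonnegative second derivative, so the one-variable convexity
    criterion applies to [psi]. Both endpoints lie in the open set [Omega], which gives continuity
    there. *)
Lemma concave_of_hessian_form_le0 (R : realType) (n : nat)
    (Omega : set 'rV[R]_n) (u : 'rV[R]_n -> R) :
  open Omega -> convex_set Omega -> smooth_on Omega u ->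
  (forall v x, Omega x -> hessian_form v u x <= 0) ->
  concave_function Omega u.
Proof.
move=> oO cO us hu t x y; rewrite !inE => Ox Oy.
pose v : 'rV[R]_n := y - x.
have Oseg (s : R) : 0 <= s <= 1 -> Omega (s *: v + x).
  move=> /andP[s0 s1].
  have -> : s *: v + x = s *: y + (1 - s) *: x.
    by rewrite /v scalerBr scalerBl scale1r addrA addrAC.
  by rewrite -inE; apply: (cO y x (Itv01 s0 s1)); rewrite inE.
pose g z := - u z; pose psi (s : R) : R := g (s *: v + x).
have gs : smooth_on Omega g by exact: smooth_onN.
have dpsi (s : R) : 0 <= s <= 1 -> derivable psi s 1.
  by move=> s01; apply/derivable_line; exact: (derive2E oO v gs (Oseg s s01)).1.
have Dpsi : 'D_1 psi = fun s => 'D_v g (s *: v + x).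
  by apply/funext => s; exact: derive_line.
have ddpsi (s : R) : 0 <= s <= 1 ->
    is_derive s 1 ('D_1 psi) (hessian_form v g (s *: v + x)).
  move=> s01; rewrite Dpsi.
  exact: (is_derive_line ('D_v g) x v s _).2 (derive2E oO v gs (Oseg s s01)).2.
have cpsi (s : R) : 0 <= s <= 1 -> {for s, continuous psi}.
  by move=> /dpsi d; apply/differentiable_continuous/derivable1_diffP.
have sub01 (s : R) : 0 < s < 1 -> 0 <= s <= 1.
  by move=> /andP[s0 s1]; rewrite !ltW.
have concl : psi (conv t (0 : R^o) (1 : R^o)) <=
    conv t (psi 0 : R^o) (psi 1 : R^o).
  apply: (@second_derivative_convex R psi 0 1 _ _ _ _ _ t ler01).
  - move=> s /sub01 s01; have [_ ->] := ddpsi s s01.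
    have -> : hessian_form v g (s *: v + x) = - hessian_form v u (s *: v + x).
      rewrite /hessian_form -sumrN; apply: eq_bigr => k _.
      by rewrite (dpartialN oO [:: k.1; k.2] us (Oseg s s01)) mulrN.
    by rewrite oppr_ge0; exact: hu (Oseg s s01).
  - apply: cvg_at_left_filter; apply: cpsi; by rewrite ler01 lexx.
  - apply: cvg_at_right_filter; apply: cpsi; by rewrite ler01 lexx.
  - by move=> s; rewrite in_itv/= => /sub01 /dpsi.
  - by move=> s; rewrite in_itv/= => /sub01 /ddpsi[].
(* The weight [t] sits on [x], so the parameter on the segment from [x] to [y] is [1 - t]. *)
move: concl; rewrite !convRE /psi /g /unstable.onem mulr0 add0r mulr1.
rewrite scale0r add0r scale1r subrK !mulrN -opprD lerN2.
rewrite [conv _ x y](_ : _ = (1 - t%:num) *: v + x)//.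
rewrite /conv/= /unstable.onem /v scalerBr.
by rewrite [(1 - _) *: x]scalerBl scale1r opprB -addrA addrNK addrC.
Qed.

Theorem theorem1p2 (R : realType) (n : nat) (n_gt0 : (0 < n)%N)
    (Omega : set 'rV[R]_n)
    (Omega_domain : domain Omega)
    (Omega_bounded : bounded_set Omega)
    (Omega_convex : convex_set Omega)
    (Omega_smooth : smooth_boundary Omega)
    (f : R -> R) (f_smooth : smooth_real f)
    (u : 'rV[R]_n -> R) (u_smooth : smooth_closure Omega u)
    (u_eq : forall x, Omega x -> - laplacian u x = f (u x))
    (u_bdry : forall x, boundary Omega x -> u x = 0)
    (f_gt0 : forall s : R, 0 < f s)
    (f_concave : forall s : R,
       0 <= s <= sup [set u x | x in closure Omega] -> (f^`(2))%classic s <= 0)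
    (u_hess : forall x, boundary Omega x -> neg_semidef (hessian Omega u x)) :
  concave_function Omega u.
Proof.
have Omega_open : open Omega by case: Omega_domain.
have [us u_cont u_ext] := u_smooth.
have u0 p : boundary Omega p -> u y @[y --> within Omega (nbhs p)] --> (0 : R).
  by move=> bp; rewrite -(u_bdry p bp); exact: u_cont bp.1.
apply: concave_of_hessian_form_le0 => // v x Ox.
apply: (hessian_form_le0 Omega_open Omega_bounded f_smooth (f_gt0 0) f_concave
  us u_eq _ _ Ox).
  (* These bounds put the values of [u] where [f] is concave; [u >= 0] because its Laplacian is
     [- f (u) < 0]. *)
  move=> y Oy; apply/andP; split; last exact: le_sup_closure.
  apply: (superharmonic_ge0 Omega_open Omega_bounded us u0 _ Oy) => z Oz.
  by rewrite -oppr_gt0 u_eq.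
move=> p bp; exists ((v *m hessian Omega u p *m v^T) 0 0); first exact: u_hess.
by apply: hessian_form_boundary => i j; exact: u_ext bp.1.
Qed.
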